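(* Let $p\ge q\ge 1$ be integers. The packing orbitope $O^{\le}_{p,q}\subseteq\mathbb{R}^{\mathcal{I}_{p,q}}$ is the orthogonal projection to the space $\mathbb{R}^{\mathcal{I}_{p,q}}$ (i.e., the image under $(x,y)\mapsto x$) of the polytope $$P_{p,q}=\{(x,y)\in\mathbb{R}^{\mathcal{I}_{p,q}}\times\mathbb{R}^{A_{p,q}} : y\in F_{p,q},\ (x,y)\text{ satisfies (a) and (b)}\},$$ where (a) is $y_{(i-1,j-1)^{\searrow}}\le x_{ij}$ for all $(i,j)\in\mathcal{I}_{p,q}$, and (b) is $x(\mathrm{bar}_{i,j})\le y(\mathrm{in}^{\searrow}(\mathrm{col}_{i,j}))$ for all $(i,j)\in\mathcal{I}_{p,q}$.
   Context: Notation: $[n]=\{1,\dots,n\}$, $[n]_0=\{0,1,\dots,n\}$, $q(i)=\min\{i,q\}$, $\mathcal{I}_{p,q}=\{(i,j)\in[p]\times[q] : i\ge j\}$. For a vector $z\in\mathbb{R}^M$ and $N\subseteq M$, $z(N)=\sum_{e\in N}z_e$. The packing orbitope $O^{\le}_{p,q}$ is the convex hull of all 0/1-matrices of size $p\times q$ whose columns are in lexicographically decreasing (i.e., non-increasing, with row 1 the most significant position) order and that have at most one 1-entry per row. Since no such matrix has a 1 above its main diagonal, the entries $(i,j)$ with $i<j$ are dropped and $O^{\le}_{p,q}$ is regarded as a subset of $\mathbb{R}^{\mathcal{I}_{p,q}}$. The directed acyclic graph $D_{p,q}=(V_{p,q},A_{p,q})$ has node set $V_{p,q}=\mathcal{I}_{p,q}\uplus([p]_0\times\{0\})\uplus\{s\}\uplus\{t\}$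 and the following arcs: - vertical arcs $(i,j)^{\downarrow}=((i,j),(i+1,j))$ for $i\in[p-1]_0$, $j\in[q(i)]_0$; - diagonal arcs $(i,j)^{\searrow}=((i,j),(i+1,j+1))$ for $i\in[p-1]_0$, $j\in[q(i+1)-1]_0$; - the arc $(s,(0,0))$; - the arcs $((p,j),t)$ for $j\in[q]_0$. $F_{p,q}\subseteq\mathbb{R}^{A_{p,q}}$ is the set of all $s$-$t$-flows in $D_{p,q}$ of flow value one without capacity restrictions: $y\ge 0$, flow conservation at every node other than $s,t$, and one unit of flow leaving $s$. For $W\subseteq V_{p,q}$, $\mathrm{in}^{\searrow}(W)$ is the set of diagonal arcs $(u,w)$ with $w\in W$, $u\notin W$. For $(i,j)\in\mathcal{I}_{p,q}$: $\mathrm{bar}_{i,j}=\{(i,\ell)\in\mathcal{I}_{p,q} : \ell\ge j\}$ and $\mathrm{col}_{i,j}=\{(k,j) : j\le k\le i\}$. *)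

(* Defs.v *)
From HB Require Import structures.
From mathcomp Require Import all_boot all_order all_algebra.
From mathcomp Require Import classical_sets reals convex.

Set Implicit Arguments.
Unset Strict Implicit.
Unset Printing Implicit Defensive.

Import Order.TTheory GRing.Theory Num.Theory.
Local Open Scope ring_scope.

(* The index set I_(p,q), counted from 0: the cell with coordinates (i, j)
   stands for the matrix position (i+1, j+1) of [p] x [q]. *)
Definition cell (p q : nat) := {ij : 'I_p * 'I_q | (ij.2 <= ij.1)%N}.
Definition crow p q (c : cell p q) : 'I_p := (val c).1.
Definition ccol p q (c : cell p q) : 'I_q := (val c).2.

Definition coord_sum (R : realType) (E : finType) (z : {ffun E -> R})
  (N : {set E}) : R := \sum_(e in N) z e.

Definition convex_hull (R : realType) (E : finType) (A : set {ffun E -> R}) :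
    set {ffun E -> R} :=
  smallest (@convex_set R {ffun E -> R^o}) A.

(* false < true, and row 0 is the most significant one. *)
Definition lex_columns p q (M : 'M[bool]_(p, q)) : Prop :=
  forall j1 j2 : 'I_q, (j1 <= j2)%N ->
    (([tuple M i j2 | i < p] : p.-tuplelexi bool) <=
     ([tuple M i j1 | i < p] : p.-tuplelexi bool))%O.

Definition packing_rows p q (M : 'M[bool]_(p, q)) : Prop :=
  forall i : 'I_p, (#|[set j | M i j]| <= 1)%N.

Definition cell_vector (R : realType) p q (M : 'M[bool]_(p, q)) :
    {ffun cell p q -> R} :=
  [ffun c => (M (crow c) (ccol c))%:R].

Definition packing_orbitope (R : realType) p q : set {ffun cell p q -> R} :=
  convex_hull [set cell_vector R M | M in
    [set M : 'M[bool]_(p, q) | lex_columns M /\ packing_rows M]]%classic.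
Arguments packing_orbitope : clear implicits.

(* Unlike cells, grid points carry the coordinates (i, j) themselves: the points
   with j > 0 form I_(p,q), those with j = 0 form [p]_0 x {0}. *)
Definition grid (p q : nat) := {ij : 'I_p.+1 * 'I_q.+1 | (ij.2 <= ij.1)%N}.
Definition grow p q (g : grid p q) : 'I_p.+1 := (val g).1.
Definition gcol p q (g : grid p q) : 'I_q.+1 := (val g).2.

Definition node (p q : nat) : finType := (grid p q + bool)%type.
Definition src {p q} : node p q := inr false.
Definition snk {p q} : node p q := inr true.
Definition origin {p q} : node p q := inl (exist _ (ord0, ord0) isT).

Lemma cell_node_subproof p q (c : cell p q) :
  (lift ord0 (ccol c) <= lift ord0 (crow c))%N.
Proof. exact: (valP c). Qed.

Definition cell_node p q (c : cell p q) : node p q :=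
  inl (exist _ (lift ord0 (crow c), lift ord0 (ccol c)) (cell_node_subproof c)).

(* The node (i-1, j-1) for the cell at matrix position (i, j). *)
Definition cell_pred p q (c : cell p q) : node p q :=
  inl (exist _ (widen_ord (leqnSn p) (crow c), widen_ord (leqnSn q) (ccol c))
    (valP c)).

Definition vertical_arc p q (u w : node p q) : bool :=
  if (u, w) is (inl g, inl h) then
    [&& (grow g < p)%N, (gcol g <= minn (grow g) q)%N,
        grow h == (grow g).+1 :> nat & gcol h == gcol g :> nat]
  else false.

Definition diagonal_arc p q (u w : node p q) : bool :=
  if (u, w) is (inl g, inl h) then
    [&& (grow g < p)%N, (gcol g < minn (grow g).+1 q)%N,
        grow h == (grow g).+1 :> nat & gcol h == (gcol g).+1 :> nat]
  else false.

Definition source_arc p q (u w : node p q) : bool := (u == src) && (w == origin).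

Definition sink_arc p q (u w : node p q) : bool :=
  if (u, w) is (inl g, inr true) then grow g == p :> nat else false.

Definition is_arc p q (a : node p q * node p q) : bool :=
  [|| vertical_arc a.1 a.2, diagonal_arc a.1 a.2, source_arc a.1 a.2
    | sink_arc a.1 a.2].

Definition arc (p q : nat) := {a : node p q * node p q | is_arc a}.
Definition arc_tail p q (a : arc p q) : node p q := (val a).1.
Definition arc_head p q (a : arc p q) : node p q := (val a).2.

Lemma diag_into_subproof p q (c : cell p q) :
  is_arc (cell_pred c, cell_node c).
Proof.
apply/or4P; apply: Or42; rewrite /diagonal_arc /grow /gcol /=.
by rewrite ltn_ord leq_min ltn_ord ltnS (valP c) !eqxx.
Qed.

(* For the cell at matrix position (i, j), the diagonal arc leaving (i-1, j-1). *)
Definition diag_into p q (c : cell p q) : arc p q :=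
  exist _ (cell_pred c, cell_node c) (diag_into_subproof c).

Definition unit_flows (R : realType) p q : set {ffun arc p q -> R} :=
  [set y | [/\ forall a, 0 <= y a,
      forall v : node p q, v != src -> v != snk ->
        \sum_(a | arc_head a == v) y a = \sum_(a | arc_tail a == v) y a
    & \sum_(a | arc_tail a == src) y a = 1]]%classic.
Arguments unit_flows : clear implicits.

Definition in_diag p q (W : {set node p q}) : {set arc p q} :=
  [set a | [&& diagonal_arc (arc_tail a) (arc_head a), arc_head a \in W
           & arc_tail a \notin W]].

Definition bar p q (c : cell p q) : {set cell p q} :=
  [set d | (crow d == crow c) && (ccol c <= ccol d)%N].

Definition column p q (c : cell p q) : {set cell p q} :=
  [set d | (ccol d == ccol c) && (ccol c <= crow d <= crow c)%N].

Definition column_nodes p q (c : cell p q) : {set node p q} :=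
  [set cell_node d | d in column c].

Definition extended_polytope (R : realType) p q :
    set ({ffun cell p q -> R} * {ffun arc p q -> R}) :=
  [set xy : {ffun cell p q -> R} * {ffun arc p q -> R} |
   [/\ unit_flows R p q xy.2,
      forall c : cell p q, xy.2 (diag_into c) <= xy.1 c
    & forall c : cell p q, coord_sum xy.1 (bar c) <=
        coord_sum xy.2 (in_diag (column_nodes c))]]%classic.
Arguments extended_polytope : clear implicits.

(* Main.v *)
(* Fix a flow y and read it as a random walk on the nodes, row by row.  A walk
   that takes a diagonal arc into column j forces the row's 1 into column j; on a
   vertical arc in column j the row is zero or has its 1 in any column <= j.  By
   conservation, (b) says that the tails of a row of x are at most the tails of
   the flow through that row, so together with (a) the entries x_ij - y_diag and
   the vertical flows satisfy stochastic domination, and the monotone coupling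
   splits each vertical flow among admissible entries.  The resulting Markov
   chain is a probability on 0/1-matrices with mean x.  Its matrices have
   restricted-growth rows (row n has its 1 at most one column beyond all earlier
   ones), which is exactly the lexicographic order of the columns.  Conversely
   such a matrix lifts to the path through the nodes (n, peak g n), where
   [peak g n] is the last column used in the first n rows. *)
Require Import Defs.
From mathcomp Require Import all_boot all_order all_algebra.
From mathcomp Require Import classical_sets reals convex.
From mathcomp Require Import interval_inference.
From mathcomp Require Import lra zify.
Import Defs.

Set Implicit Arguments.
Unset Strict Implicit.
Unset Printing Implicit Defensive.

Import Order.TTheory GRing.Theory Num.Theory.
Local Open Scope ring_scope.

(** * Convex combinations, summation identities and the quantile coupling *)

(** Binary convexity is iterated along the index list. Partial sums are rescaled by their total
    weight, so that each one is again a convex combination; zero weights are split off because the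
    rescaling needs a positive total. *)
Lemma convex_set_sum (R : realType) (V : lmodType R)
    (A : set (convex_lmodType V)) (I : finType) (w : I -> R) (v : I -> V) :
  convex_set A -> (forall i, 0 <= w i) -> \sum_i w i = 1 ->
  (forall i, w i != 0 -> A (v i)) -> A (\sum_i w i *: v i).
Proof.
move=> cA w_ge0 sumw Av.
suff IH (s : seq I) : 0 < \sum_(i <- s) w i ->
    A ((\sum_(i <- s) w i)^-1 *: \sum_(i <- s) w i *: v i).
  by have := IH (index_enum I); rewrite sumw ltr01 invr1 scale1r; apply.
elim: s => [|i s IHs]; first by rewrite big_nil ltxx.
rewrite !big_cons; set W := \sum_(j <- s) w j; set S := \sum_(j <- s) _.
have W_ge0 : 0 <= W by apply: sumr_ge0.
have [wi0|wi0] := eqVneq (w i) 0.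
  by rewrite wi0 add0r scale0r add0r; exact: IHs.
have [W0|W0] := eqVneq W 0.
  move=> _; have -> : S = 0.
    rewrite /S big_seq big1// => j js; move/eqP: W0.
    rewrite psumr_eq0// => /allP/(_ j js)/eqP->.
    by rewrite scale0r.
  by rewrite W0 !addr0 scalerA mulVf// scale1r; exact: Av.
move=> tot_gt0; have tot0 : w i + W != 0 by rewrite gt_eqF.
have lam01 : 0 <= w i / (w i + W) <= 1.
  by rewrite divr_ge0 ?(ltW tot_gt0)//= ler_pdivrMr// mul1r lerDl.
have /andP[lam0 lam1] := lam01.
have := cA (v i) (W^-1 *: S) (Itv01 lam0 lam1).
rewrite !inE => /(_ (Av _ wi0)) /(_ (IHs _)).
rewrite lt0r W0 W_ge0 => /(_ isT).
rewrite /conv/= /unstable.onem => H.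
suff -> : (w i + W)^-1 *: (w i *: v i + S) =
  (w i / (w i + W)) *: v i + (1 - w i / (w i + W)) *: (W^-1 *: S) by [].
rewrite scalerDr !scalerA [_^-1 * w i]mulrC; congr (_ + _ *: _).
by rewrite -{1}(divff tot0) -mulrBl [w i + W]addrC addrK mulrAC mulfV// mul1r addrC.
Qed.

Lemma sum_by_key (R : nmodType) (E : finType) (P : pred E) (key : E -> nat)
    (F : E -> R) (lo hi : nat) :
  \sum_(lo <= k < hi) \sum_(e | P e && (key e == k)) F e =
  \sum_(e | P e && (lo <= key e < hi)%N) F e.
Proof.
under eq_bigr do rewrite big_mkcondr.
rewrite exchange_big/= [RHS]big_mkcondr; apply: eq_bigr => e _.
rewrite -big_mkcond -(big_nat1_eq +%R (fun=> F e) (key e) lo hi).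
by apply: eq_bigl => k; rewrite eq_sym.
Qed.

Lemma telescope_sumr_opp (V : zmodType) (f : nat -> V) (n : nat) :
  \sum_(0 <= k < n) (f k - f k.+1) = f 0%N - f n.
Proof.
under eq_bigr do rewrite -opprB.
by rewrite sumrN telescope_sumr// opprB.
Qed.

(* The rectangle increments of [min (A l) (B j)], which is the joint tail of the
   quantile coupling of two laws with tails [A] and [B]. *)
Definition coupling (R : realType) (A B : nat -> R) (j l : nat) : R :=
  let m l j := Num.min (A l) (B j) in
  (m l j - m l.+1 j) - (m l j.+1 - m l.+1 j.+1).

(** Nonnegativity is the supermodularity of [min]. For [j < l] domination gives [A l <= B j.+1], so
    all four minima equal their [A] argument and cancel. The marginals telescope, since both tails
    start at a common maximum and end at 0. *)
Lemma monotone_coupling (R : realType) (N : nat) (A B : nat -> R) :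
  {homo A : m n / (m <= n)%N >-> n <= m} ->
  {homo B : m n / (m <= n)%N >-> n <= m} ->
  (forall n, A n <= B n) -> A 0 = B 0 -> A N = 0 -> B N = 0 ->
  let Z := coupling A B in
  [/\ forall j l, 0 <= Z j l, forall j l, (j < l)%N -> Z j l = 0,
    forall j, (j < N)%N -> \sum_(0 <= l < N) Z j l = B j - B j.+1 &
    forall l, (l < N)%N -> \sum_(0 <= j < N) Z j l = A l - A l.+1].
Proof.
move=> decA decB leAB A0 AN BN.
pose m l j := Num.min (A l) (B j).
rewrite /coupling -/m; split.
- move=> j l; rewrite /m.
  have := decA _ _ (leqnSn l); have := decB _ _ (leqnSn j).
  case: (leP (A l) (B j)); case: (leP (A l) (B j.+1));
  case: (leP (A l.+1) (B j)); case: (leP (A l.+1) (B j.+1)); lra.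
- move=> j l lejl; rewrite /m.
  have hA := decA _ _ lejl; have hA' := decA _ _ (leqnSn l).
  have hB := decB _ _ (leqnSn j); have hAB := leAB j.+1.
  by rewrite !min_l; lra.
- move=> j ltjN; rewrite sumrB !telescope_sumr_opp /m A0 AN.
  have := decB _ _ (leq0n j); have := decB _ _ (leq0n j.+1).
  have := decB _ _ ltjN; have := decB _ _ (ltnW ltjN); rewrite BN.
  by move=> *; rewrite ![Num.min (B _) _]min_r// !min_l//; lra.
- move=> l ltlN.
  transitivity (\sum_(0 <= j < N) ((m l j - m l j.+1) -
      (m l.+1 j - m l.+1 j.+1))); first by apply: eq_bigr => j _; rewrite /m; lra.
  rewrite sumrB !telescope_sumr_opp /m BN -A0.
  have := decA _ _ (leq0n l); have := decA _ _ (leq0n l.+1).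
  have := decA _ _ ltlN; have := decA _ _ (ltnW ltlN); rewrite AN.
  by move=> *; rewrite ![Num.min _ 0]min_r// !min_l//; lra.
Qed.

(** * Realising a Markov chain as a finite distribution on sequences *)

Definition peak (g : nat -> nat) (n : nat) : nat := \max_(i < n) g i.

Lemma peakS (g : nat -> nat) n : peak g n.+1 = maxn (peak g n) (g n).
Proof. by rewrite /peak big_ord_recr. Qed.

Lemma eq_peak (g h : nat -> nat) n :
  (forall i, (i < n)%N -> g i = h i) -> peak g n = peak h n.
Proof. by move=> gh; apply: eq_bigr => i _; exact: gh. Qed.

(** The state before row [n] is the peak so far, with law [Y n]; [T n j l] is the joint mass of
    state [j] and entry [l], and the next state is [maxn j l]. The sample space gains one factor
    ['I_N] per row. *)
Lemma markov_realization (R : realType) (p N : nat) (T : nat -> nat -> nat -> R)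
    (Y : nat -> nat -> R) :
  (0 < N)%N ->
  (forall n j l, (n < p)%N -> 0 <= T n j l) ->
  (forall n j l, (n < p)%N -> (j.+1 < l)%N -> T n j l = 0) ->
  (forall n j, (n < p)%N -> (j < N)%N -> \sum_(0 <= l < N) T n j l = Y n j) ->
  (forall n k, (n < p)%N -> (k < N)%N ->
    \sum_(0 <= j < N) \sum_(0 <= l < N | maxn j l == k) T n j l = Y n.+1 k) ->
  (forall j, Y 0%N j = (j == 0%N)%:R) ->
  exists (I : finType) (w : I -> R) (f : I -> nat -> nat),
  [/\ forall i, 0 <= w i, \sum_i w i = 1,
    forall i, w i != 0 -> forall n, (n < p)%N -> (f i n <= (peak (f i) n).+1)%N &
    forall n l, (n < p)%N -> (l < N)%N ->
      \sum_(i | f i n == l) w i = \sum_(0 <= j < N) T n j l].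
Proof.
move=> N_gt0 T_ge0 T_supp T_row T_next Y0.
(* The induction must also carry the law of the peak, which is the denominator when the next row is
   attached. *)
suff [I [w [f [w_ge0 sumw w_supp f_law _]]]] :
    exists (I : finType) (w : I -> R) (f : I -> nat -> nat),
    [/\ forall i, 0 <= w i, \sum_i w i = 1,
      forall i, w i != 0 ->
        forall n, (n < p)%N -> (f i n <= (peak (f i) n).+1)%N,
      forall n l, (n < p)%N -> (l < N)%N ->
        \sum_(i | f i n == l) w i = \sum_(0 <= j < N) T n j l
      & (forall i, (peak (f i) p < N)%N) /\
        forall j, (j < N)%N -> \sum_(i | peak (f i) p == j) w i = Y p j].
  by exists I, w, f.
elim: p T_ge0 T_supp T_row T_next => [|p IHp] T_ge0 T_supp T_row T_next.
  exists unit, (fun=> 1), (fun=> fun=> 0%N); split=> //.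
  - by rewrite big_const card_unit /= addr0.
  - split=> [i|j _]; first by rewrite /peak big_ord0.
    rewrite /peak big_ord0 Y0 eq_sym.
    case: (j =P 0%N) => _; last by rewrite big_pred0.
    by rewrite big_const card_unit /= addr0.
have [||||I [w [f [w_ge0 sumw w_supp f_law [f_lt peak_law]]]]] := IHp.
- by move=> n j l ltnp; apply: T_ge0; exact: ltnW.
- by move=> n j l ltnp; apply: T_supp; exact: ltnW.
- by move=> n j ltnp; apply: T_row; exact: ltnW.
- by move=> n k ltnp; apply: T_next; exact: ltnW.
pose pk i := peak (f i) p.
(* Conditional probability of entry [l] given the current peak. If the denominator is 0, the
   quotient is 0 by convention, and [w i] is 0 as well ([w0_Y0]). *)
pose K i l := T p (pk i) l / Y p (pk i).
have Y_ge0 j : (j < N)%N -> 0 <= Y p j.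
  by move=> ltjN; rewrite -T_row//; apply: sumr_ge0 => l _; exact: T_ge0.
have K_ge0 i l : 0 <= K i l.
  by rewrite divr_ge0 ?T_ge0 ?Y_ge0 ?f_lt.
have w0_Y0 i : Y p (pk i) = 0 -> w i = 0.
  rewrite -peak_law ?f_lt// => /eqP; rewrite psumr_eq0//.
  by move=> /allP/(_ i (mem_index_enum _)); rewrite eqxx/= => /eqP.
have sumK i : w i * \sum_(l < N) K i l = w i.
  have [/w0_Y0 ->|Yn0] := eqVneq (Y p (pk i)) 0; first by rewrite mul0r.
  by rewrite -mulr_suml -(big_mkord xpredT) T_row ?f_lt// divff// mulr1.
(* One identity for any event in peak and entry: it serves both the law of the new entry and the law
   of the new peak. *)
have transport (G : nat -> nat -> bool) :
    \sum_(e : I * 'I_N | G (pk e.1) e.2) w e.1 * K e.1 e.2 =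
    \sum_(0 <= j < N) \sum_(0 <= l < N | G j l) T p j l.
  rewrite -(pair_big_dep xpredT (fun i (l : 'I_N) => G (pk i) l)
    (fun i (l : 'I_N) => w i * K i l))/=.
  transitivity (\sum_(0 <= j < N) \sum_(i | xpredT i && (pk i == j))
      \sum_(l < N | G (pk i) l) w i * K i l).
    by rewrite sum_by_key; apply: eq_bigl => i; rewrite f_lt.
  apply: eq_big_nat => j /= ltjN.
  transitivity (\sum_(i | pk i == j)
      w i * ((\sum_(0 <= l < N | G j l) T p j l) / Y p j)).
    apply: eq_bigr => i /eqP pkj; rewrite -mulr_sumr mulr_suml big_mkord.
    by congr (_ * _); rewrite /K pkj.
  rewrite -mulr_suml peak_law//.
  have [Yj0|Yj0] := eqVneq (Y p j) 0; last by rewrite mulrC divfK.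
  rewrite Yj0 mul0r big1_seq// => l /andP[_ lN].
  move/eqP: Yj0; rewrite -T_row// psumr_eq0 => [/allP/(_ l lN)/eqP//|i _].
  exact: T_ge0.
pose f' (e : I * 'I_N) k : nat := if k == p then e.2 : nat else f e.1 k.
have f'E e k : (k < p)%N -> f' e k = f e.1 k by rewrite /f'; case: ltngtP.
have f'p e : f' e p = e.2 by rewrite /f' eqxx.
have pkE e k : (k <= p)%N -> peak (f' e) k = peak (f e.1) k.
  by move=> lekp; apply: eq_peak => i ltik; rewrite f'E// (leq_trans ltik).
have pkS e : peak (f' e) p.+1 = maxn (pk e.1) e.2 by rewrite peakS pkE// f'p.
exists (I * 'I_N)%type, (fun e : I * 'I_N => w e.1 * K e.1 e.2), f'; split.
- by move=> e; rewrite mulr_ge0.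
- rewrite -(pair_bigA _ (fun i (l : 'I_N) => w i * K i l))/= -sumw.
  by apply: eq_bigr => i _; rewrite -mulr_sumr sumK.
- move=> e; rewrite mulf_eq0 negb_or => /andP[we0 Ke0] n.
  rewrite ltnS leq_eqVlt => /predU1P[->|ltnp].
    rewrite f'p pkE// leqNgt; apply: contra_neqN Ke0 => lt.
    by rewrite /K T_supp ?mul0r.
  by rewrite f'E// pkE ?(ltnW ltnp)//; exact: w_supp.
- move=> n l; rewrite ltnS leq_eqVlt => /predU1P[->|ltnp] ltlN.
    under eq_bigl do rewrite f'p.
    rewrite (transport (fun _ => eq_op^~ l)); apply: eq_big_nat => j _.
    by rewrite big_nat1_eq ltlN.
  under eq_bigl do rewrite f'E// -[_ == l]andbT.
  rewrite -(pair_big_dep (fun i => f i n == l) (fun _ _ => true)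
    (fun i (l : 'I_N) => w i * K i l))/= -f_law//.
  by apply: eq_bigr => i _; rewrite -mulr_sumr sumK.
- split=> [e|k ltkN]; first by rewrite pkS gtn_max f_lt ltn_ord.
  under eq_bigl do rewrite pkS.
  by rewrite (transport (fun j l => maxn j l == k)) T_next.
Qed.

(** * Restricted-growth sequences and lexicographically ordered columns *)

(** The restricted growth condition that encodes set partitions, except that 0 may occur anywhere,
    for an empty row. *)
Definition restricted_growth (p : nat) (g : nat -> nat) : Prop :=
  forall n, (n < p)%N -> (g n <= (peak g n).+1)%N.

(* Row [i] has its 1 in column [g i], columns being counted from 1, and is zero
   when [g i = 0]. *)
Definition choice_matrix (p q : nat) (g : nat -> nat) : 'M[bool]_(p, q) :=
  \matrix_(i, j) (g i == j.+1).

(** The peak rises by at most one per step, always to the current entry, so no value below it is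
    skipped. *)
Lemma restricted_growth_attained p g n c : restricted_growth p g ->
  (n <= p)%N -> (0 < c)%N -> (c <= peak g n)%N ->
  exists2 i, (i < n)%N & g i = c.
Proof.
move=> rg; elim: n => [|n IHn] ltnp c_gt0; first by rewrite /peak big_ord0; case: c c_gt0.
rewrite peakS leq_max; case: (leqP c (peak g n)) => [lec _|ltc /= lec].
  by have [i ltin gi] := IHn (ltnW ltnp) c_gt0 lec; exists i; rewrite // ltnS ltnW.
by exists n => //; apply/eqP; rewrite eqn_leq lec andbT (leq_trans (rg _ ltnp)).
Qed.

Lemma peak_le p g n : restricted_growth p g -> (n <= p)%N -> (peak g n <= n)%N.
Proof.
move=> rg; elim: n => [|n IHn] ltnp; first by rewrite /peak big_ord0.
rewrite peakS geq_max (leq_trans (IHn (ltnW ltnp)))//=.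
by rewrite (leq_trans (rg _ ltnp))// ltnS IHn// ltnW.
Qed.

Lemma choice_matrix_packing p q g : packing_rows (choice_matrix p q g).
Proof.
move=> i; apply/card_le1_eqP => j k; rewrite !inE !mxE.
by move=> /eqP -> /eqP[jk]; apply/val_inj.
Qed.

(** A 1 in column [j2] forces an earlier 1 in column [j1], so the first row where the two columns
    differ favours [j1]. *)
Lemma choice_matrix_lex p q g : restricted_growth p g ->
  lex_columns (choice_matrix p q g).
Proof.
move=> rg j1 j2; rewrite leq_eqVlt => /predU1P[/val_inj->//|lt12].
apply/lexi_tupleP.
have earlier (n : 'I_p) : g n = j2.+1 -> exists2 i : 'I_p, (i < n)%N & g i = j1.+1.
  move=> gn; have ltnp := ltn_ord n.
  have [||i ltin gi] := @restricted_growth_attained p g n j1.+1 rg (ltnW ltnp) => //.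
    by have := rg _ ltnp; rewrite gn ltnS; exact: leq_trans.
  by exists (Ordinal (ltn_trans ltin ltnp)).
case: (pickP (fun i : 'I_p => g i == j1.+1)) => [i0 gi0|none]; last first.
  (* [ord_max] lies one past the last row and so certifies equality: with [j1] empty, [j2] is empty
     too. *)
  exists ord_max => i _; rewrite !tnth_mktuple !mxE none.
  case: eqP => [/earlier[k _ /eqP]|_]; first by rewrite none.
  by rewrite neq_ltn ltn_ord; split.
have [k /eqP gk mink] := @arg_minnP _ i0 (fun i => g i == j1.+1) val gi0.
(* The columns first differ at [k], the topmost 1 of column [j1]; above it both are zero. *)
exists (widen_ord (leqnSn p) k) => i /= leik; rewrite !tnth_mktuple !mxE.
have -> : (g i == j2.+1) = false.
  apply: contraTF leik => /eqP/earlier[l ltli /eqP /mink lekl].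
  by rewrite -ltnNge (leq_ltn_trans lekl).
case: (eqVneq (i : nat) k) => [->|neik]; first by rewrite gk eqxx.
case: eqP => [/eqP/mink|_]; last by [].
by move=> leki; rewrite eqn_leq leik leki in neik.
Qed.

Lemma choice_matrixP p q (M : 'M[bool]_(p, q)) :
  lex_columns M -> packing_rows M ->
  exists g, [/\ forall i, (g i <= q)%N, restricted_growth p g &
    M = choice_matrix p q g].
Proof.
move=> lexM packM.
pose g (n : nat) : nat := if insub n is Some i then
  if [pick j | M i j] is Some j then (j : 'I_q).+1 else 0%N else 0%N.
have gE (i : 'I_p) : g i = if [pick j | M i j] is Some j then (j : 'I_q).+1 else 0%N.
  by rewrite /g valK.
have ME (i : 'I_p) (j : 'I_q) : M i j = (g i == j.+1).
  rewrite gE; case: pickP => [k Mik|->//]; rewrite eqSS.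
  apply/idP/eqP => [Mij|/val_inj<-//]; congr val.
  by have /card_le1_eqP := packM i; apply; rewrite inE.
have g_le n : (g n <= q)%N.
  by rewrite /g; case: insub => [i|//]; case: pickP.
exists g; split=> //; last by apply/matrixP => i j; rewrite mxE.
move=> n ltnp; rewrite leqNgt; apply/negP => lt_gn.
(* An entry that jumps too far has the form [c.+2]. The 0-based columns [c] and [c.+1] are then both
   zero above row [n], while row [n] has its 1 in the right one, against the order. *)
case Egn: (g n) => [|[|c]]; rewrite Egn // in lt_gn.
have ltcq : (c.+1 < q)%N by rewrite -Egn.
have low i : (i < n)%N -> (g i < c.+1)%N.
  move=> ltin; rewrite !ltnS in lt_gn *; apply: leq_trans lt_gn.
  by rewrite /peak (leq_bigmax (Ordinal ltin)).
have /lexi_tupleP[k Hk] := lexM (Ordinal (ltnW ltcq)) (Ordinal ltcq) (leqnSn c).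
have [ltkn|lenk] := ltnP k n.
  have ltkp := ltn_trans ltkn ltnp.
  have := Hk (Ordinal ltkp) (leqnn _); rewrite !tnth_mktuple !ME /= => -[_].
  by rewrite eqxx !ltn_eqF//= ?low// ltnW// ltnS low.
have := Hk (Ordinal ltnp) lenk; rewrite !tnth_mktuple !ME /= Egn => -[+ _].
by rewrite eqxx eqn_leq ltnn.
Qed.

(** * Nodes and arcs of the network in coordinates *)

(** Coordinates are plain naturals, so sums may run beyond the grid, where the predicate is
    false. *)
Definition node_at p q (u : node p q) (n j : nat) : bool :=
  if u is inl g then (grow g == n :> nat) && (gcol g == j :> nat) else false.

Definition is_vertical p q (a : arc p q) := vertical_arc (arc_tail a) (arc_head a).
Definition is_diagonal p q (a : arc p q) := diagonal_arc (arc_tail a) (arc_head a).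

Lemma grid_inj p q (g h : grid p q) :
  grow g = grow h :> nat -> gcol g = gcol h :> nat -> g = h.
Proof.
case: g h => [[i j] gP] [[k l] hP]; rewrite /grow /gcol /=.
by move=> /val_inj rE /val_inj cE; apply: val_inj; rewrite /= rE cE.
Qed.

Lemma cell_exists p q i j : (i < p)%N -> (j < q)%N -> (j <= i)%N ->
  exists c : cell p q, crow c = i :> nat /\ ccol c = j :> nat.
Proof.
move=> ltip ltjq leji.
by exists (exist _ (Ordinal ltip, Ordinal ltjq) leji).
Qed.

(** The lower row bound of [column] disappears because every grid point already satisfies it. *)
Lemma mem_column_nodes p q (c : cell p q) (u : node p q) :
  (u \in column_nodes c) =
  if u is inl g then (gcol g == (ccol c).+1 :> nat) && (grow g <= (crow c).+1)%N
  else false.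
Proof.
apply/imsetP/idP => [[d]|].
  rewrite inE => /andP[/eqP dc /andP[_ led]] ->.
  by rewrite /grow /gcol /= /bump leq0n !add1n dc eqxx ltnS.
case: u => [g|//] /andP[/eqP gc ler].
have := valP g; rewrite /= -/(grow g) -/(gcol g) gc => lt.
have rK : (grow g).-1.+1 = grow g by rewrite prednK// (leq_trans _ lt).
have ltip : ((grow g).-1 < p)%N.
  by rewrite (leq_trans _ (ltn_ord (crow c)))// -ltnS rK.
have [d [dr dc]] : exists d : cell p q,
    crow d = (grow g).-1 :> nat /\ ccol d = ccol c :> nat.
  by apply: cell_exists; rewrite // -ltnS rK.
exists d; last first.
  congr inl; apply: grid_inj; rewrite /grow /gcol /= /bump leq0n add1n -/(grow g) -/(gcol g).
    by rewrite dr rK.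
  by rewrite dc gc.
rewrite inE -val_eqE /= dc eqxx dr /=.
by rewrite -ltnS rK lt -ltnS rK.
Qed.

(** The boolean indices let one case analysis on [arcP] also evaluate [is_vertical] and
    [is_diagonal]. *)
Variant arc_spec p q : node p q -> node p q -> bool -> bool -> Prop :=
| VerticalArc g h of (grow g < p)%N & grow h = (grow g).+1 :> nat
    & gcol h = gcol g :> nat : arc_spec (inl g) (inl h) true false
| DiagonalArc g h of (grow g < p)%N & grow h = (grow g).+1 :> nat
    & gcol h = (gcol g).+1 :> nat : arc_spec (inl g) (inl h) false true
| SourceArc : arc_spec src origin false false
| SinkArc g of grow g = p :> nat : arc_spec (inl g) snk false false.

Lemma arcP p q (a : arc p q) :
  arc_spec (arc_tail a) (arc_head a) (is_vertical a) (is_diagonal a).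
Proof.
rewrite /is_vertical /is_diagonal; case: a => -[u w] /=.
rewrite /arc_tail /arc_head /= => /or4P[] /= Ha.
- case: u w Ha => [g|[]] [h|[]] // Ha; have /and4P[ltp _ /eqP rE /eqP cE] := Ha.
  have -> : diagonal_arc (inl g) (inl h) = false.
    by apply/negP => /and4P[_ _ _]; rewrite cE ltn_eqF.
  by rewrite Ha; exact: VerticalArc.
- case: u w Ha => [g|[]] [h|[]] // Ha; have /and4P[ltp _ /eqP rE /eqP cE] := Ha.
  have -> : vertical_arc (inl g) (inl h) = false.
    by apply/negP => /and4P[_ _ _]; rewrite cE gtn_eqF.
  by rewrite Ha; exact: DiagonalArc.
- by case/andP: Ha => /eqP -> /eqP ->; constructor.
- by case: u w Ha => [g|[]] [h|[]] // /eqP rE; constructor.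
Qed.

Lemma arc_inj p q (a b : arc p q) :
  arc_tail a = arc_tail b -> arc_head a = arc_head b -> a = b.
Proof.
by case: a b => [[u w] Ha] [[u' w'] Hb] ? ?; apply: val_inj; congr pair.
Qed.

Lemma is_diagonal_diag_into p q (c : cell p q) : is_diagonal (diag_into c).
Proof.
rewrite /is_diagonal /arc_tail /arc_head /= /diagonal_arc /grow /gcol /=.
by rewrite ltn_ord leq_min ltn_ord ltnS (valP c) !eqxx.
Qed.

Lemma tail_at_nonvertical p q (a : arc p q) n j : (n < p)%N ->
  node_at (arc_tail a) n j && ~~ is_vertical a =
  is_diagonal a && node_at (arc_tail a) n j.
Proof.
by case: arcP => [g h|g h||g /= ->] *; rewrite ?andbT ?andbF// gtn_eqF.
Qed.

Lemma head_at_vertical p q (a : arc p q) n j :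
  node_at (arc_head a) n.+1 j && is_vertical a =
  is_vertical a && node_at (arc_tail a) n j.
Proof.
by case: arcP => [g h ? /= -> ->|g h||g] *; rewrite ?andbF// andbT eqSS.
Qed.

Lemma head_at_nonvertical p q (a : arc p q) n j :
  node_at (arc_head a) n.+1 j && ~~ is_vertical a =
  [&& (0 < j)%N, is_diagonal a & node_at (arc_tail a) n j.-1].
Proof.
case: arcP => [g h|g h ? /= -> ->||g] *; rewrite ?andbF//.
by case: j => [|j]; rewrite andbT ?andbF// !eqSS.
Qed.

Lemma head_at_top p q (a : arc p q) j :
  node_at (arc_head a) 0 j = (arc_tail a == src) && (j == 0%N).
Proof.
by case: arcP => [g h ? /= ->|g h ? /= ->||g _] //; rewrite eqxx [RHS]eq_sym.
Qed.

(** * Flow through rows and columns *)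

Section Flow.
Context {R : realType} {p q : nat} (y : {ffun arc p q -> R}).

Definition vflow (n j : nat) : R :=
  \sum_(a | is_vertical a && node_at (arc_tail a) n j) y a.
Definition dflow (n j : nat) : R :=
  \sum_(a | is_diagonal a && node_at (arc_tail a) n j) y a.
Definition nflow (n j : nat) : R := \sum_(a | node_at (arc_head a) n j) y a.

Lemma nflow_in n j :
  nflow n.+1 j = vflow n j + (if (0 < j)%N then dflow n j.-1 else 0).
Proof.
rewrite /nflow (bigID (@is_vertical p q))/=; congr (_ + _).
  by apply: eq_bigl => a; rewrite head_at_vertical.
under eq_bigl do rewrite head_at_nonvertical.
by case: ifP => _ //=; rewrite big_pred0.
Qed.

Hypothesis y_flow : unit_flows R p q y.

Lemma vflow_ge0 n j : 0 <= vflow n j.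
Proof. by case: y_flow => y_ge0 _ _; apply: sumr_ge0. Qed.

Lemma dflow_ge0 n j : 0 <= dflow n j.
Proof. by case: y_flow => y_ge0 _ _; apply: sumr_ge0. Qed.

(** Conservation summed over the node; [n < p] excludes sink arcs, so only vertical and diagonal
    arcs leave. *)
Lemma nflow_out n j : (n < p)%N -> nflow n j = vflow n j + dflow n j.
Proof.
move=> ltnp; case: y_flow => _ y_cons _.
transitivity (\sum_(a | node_at (arc_tail a) n j) y a).
  rewrite /nflow (partition_big (@arc_head p q) (fun v => node_at v n j))//=.
  rewrite [RHS](partition_big (@arc_tail p q) (fun v => node_at v n j))//=.
  apply: eq_bigr => v v_at.
  transitivity (\sum_(a | arc_head a == v) y a).
    by apply: eq_bigl => a; case: eqP => [->|]; rewrite ?v_at ?andbF.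
  rewrite y_cons; try by apply: contraTneq v_at => ->.
  by apply: eq_bigl => a; case: eqP => [->|]; rewrite ?v_at ?andbF.
rewrite (bigID (@is_vertical p q))/=; congr (_ + _).
  by apply: eq_bigl => a; rewrite andbC.
by apply: eq_bigl => a; rewrite tail_at_nonvertical.
Qed.

Lemma nflow_top j : nflow 0 j = (j == 0%N)%:R.
Proof.
case: y_flow => _ _ y_src; rewrite /nflow; under eq_bigl do rewrite head_at_top.
case: eqP => _ /=; last by rewrite big_pred0// => a; rewrite andbF.
by rewrite -y_src; apply: eq_bigl => a; rewrite andbT.
Qed.

Lemma dflow_ge n j : (q <= j)%N -> dflow n j = 0.
Proof.
move=> leqj; rewrite /dflow big_pred0// => a.
case: arcP => //= g h _ _ hE; rewrite [nat_of_ord _ == j]ltn_eqF ?andbF//.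
by apply: leq_trans leqj; have := ltn_ord (gcol h); rewrite hE ltnS.
Qed.

Lemma dflow_gt_row n j : (n < j)%N -> dflow n j = 0.
Proof.
move=> ltnj; rewrite /dflow big_pred0// => a.
case: arcP => //= g h _ _ _; apply/negP => /andP[/eqP gr /eqP gc].
by have := valP g; rewrite -/(grow g) -/(gcol g) gr gc leqNgt ltnj.
Qed.

(* Constraint (b) thus bounds a row tail of [x] by the flow in that tail. *)
Lemma tail_nflow n j : (n <= p)%N ->
  \sum_(j.+1 <= k < q.+1) nflow n k = \sum_(0 <= m < n) dflow m j.
Proof.
have [leqj _|ltjq] := leqP q j.
  by rewrite big_geq// big1// => m _; rewrite dflow_ge.
elim: n => [_|n IHn ltnp].
  by rewrite [RHS]big_geq// big_nat big1// => -[|k] // _; rewrite nflow_top.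
rewrite [RHS]big_nat_recr//= -IHn 1?ltnW//.
transitivity (\sum_(j.+1 <= k < q.+1) (vflow n k + dflow n k.-1)).
  by apply: eq_big_nat => -[|k] //= _; rewrite nflow_in.
under [X in _ = X + _]eq_bigr do rewrite nflow_out//.
rewrite !big_split/= -addrA; congr (_ + _).
(* Diagonal flow into columns [j.+1] to [q] exceeds the diagonal flow out of them by [dflow n j], as
   none leaves column [q]. *)
by rewrite big_add1/= big_ltn// [in RHS]big_nat_recr//= (dflow_ge _ (leqnn q)) addr0 addrC.
Qed.

(** The arcs are sorted by the row of their tail. A diagonal arc into the column has its tail one
    column to the left, hence outside the set. *)
Lemma sum_in_diag (c : cell p q) :
  coord_sum y (in_diag (column_nodes c)) =
  \sum_(0 <= m < (crow c).+1) dflow m (ccol c).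
Proof.
pose trow (a : arc p q) := if arc_tail a is inl g then grow g : nat else 0%N.
transitivity (\sum_(0 <= m < (crow c).+1)
    \sum_(a | is_diagonal a && node_at (arc_tail a) (trow a) (ccol c)
               && (trow a == m)) y a); last first.
  apply: eq_bigr => m _; apply: eq_bigl => a; rewrite -andbA; congr (_ && _).
  by rewrite /trow; case: (arc_tail a) => [g|//] /=; rewrite eqxx andbC.
rewrite sum_by_key; apply: eq_bigl => a; rewrite inE leq0n /= ltnS.
rewrite -/(is_diagonal a) /trow.
rewrite !mem_column_nodes.
case: arcP => //= g h ltgp rE cE; rewrite eqxx /= rE cE eqSS ltnS.
by case: (gcol g =P ccol c :> nat) => [->|]//=; rewrite ltn_eqF// andbT.
Qed.

Lemma dflow_diag_into (c : cell p q) :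
  dflow (crow c) (ccol c) = y (diag_into c).
Proof.
rewrite /dflow (big_pred1 (diag_into c))// => a /=.
suff E : is_diagonal a && node_at (arc_tail a) (crow c) (ccol c) ->
    arc_tail a = cell_pred c /\ arc_head a = cell_node c.
  apply/idP/eqP => [/E[tE hE]|->].
    exact: arc_inj.
  by rewrite is_diagonal_diag_into /node_at /= /grow /gcol /= !eqxx.
case: arcP => //= g h _ rE cE /andP[/eqP gr /eqP gc].
split; congr inl; apply: grid_inj.
- by rewrite gr.
- by rewrite gc.
- by rewrite rE gr.
- by rewrite cE gc.
Qed.
End Flow.

(** * From a point of the extended polytope to a distribution on matrices *)

Lemma tail_sum_le (R : numDomainType) (F : nat -> R) (N m n : nat) :
  (forall k, (m <= k)%N -> 0 <= F k) -> (m <= n)%N ->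
  \sum_(n <= k < N) F k <= \sum_(m <= k < N) F k.
Proof.
move=> F_ge0 lemn; have [leNn|ltnN] := leqP N n.
  rewrite big_geq//; rewrite big_nat_cond; apply: sumr_ge0 => k.
  by rewrite andbT => /andP[lemk _]; exact: F_ge0.
rewrite [leRHS](big_cat_nat (n := n))//= 1?ltnW// lerDr.
rewrite big_nat_cond; apply: sumr_ge0 => k.
by rewrite andbT => /andP[lemk _]; exact: F_ge0.
Qed.

Section Projection.
Context {R : realType} {p q : nat}.
Variables (x : {ffun cell p q -> R}) (y : {ffun arc p q -> R}).

(** Columns are counted from 1 to match grid columns; positions outside the triangle, column 0
    included, get 0. *)
Definition row_entry (n l : nat) : R :=
  \sum_(c : cell p q | (crow c == n :> nat) && ((ccol c).+1 == l)) x c.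

Lemma row_entry_cell (c : cell p q) : row_entry (crow c) (ccol c).+1 = x c.
Proof. by rewrite /row_entry (big_pred1 c). Qed.

Lemma row_entry_tail (c : cell p q) :
  \sum_((ccol c).+1 <= l < q.+1) row_entry (crow c) l = coord_sum x (bar c).
Proof.
rewrite /row_entry (sum_by_key (fun d => crow d == crow c :> nat)
  (fun d => (ccol d).+1)).
by apply: eq_bigl => d; rewrite inE /= !ltnS ltn_ord andbT.
Qed.

Lemma row_entry_gt n l : (n.+1 < l)%N -> row_entry n l = 0.
Proof.
move=> ltnl; rewrite /row_entry big_pred0// => c; apply/negP => /andP[/eqP rE /eqP cE].
by have := valP c; rewrite -/(crow c) -/(ccol c) leqNgt rE -ltnS cE ltnl.
Qed.

Lemma row_entry_large n l : (q < l)%N -> row_entry n l = 0.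
Proof.
move=> ltql; rewrite /row_entry big_pred0// => c; apply/negP => /andP[_ /eqP cE].
by have := ltn_ord (ccol c); rewrite leqNgt cE ltql.
Qed.

Hypothesis y_flow : unit_flows R p q y.
Hypothesis diag_le : forall c, y (diag_into c) <= x c.
Hypothesis bar_le : forall c,
  coord_sum x (bar c) <= coord_sum y (in_diag (column_nodes c)).

(** Constraint (a), extended to all columns: outside the triangle both sides vanish. *)
Lemma dflow_le n l : (n < p)%N -> dflow y n l <= row_entry n l.+1.
Proof.
move=> ltnp; have [leql|ltlq] := leqP q l.
  by rewrite dflow_ge// row_entry_large.
have [ltnl|leln] := ltnP n l; first by rewrite dflow_gt_row// row_entry_gt.
have [c [<- <-]] := cell_exists ltnp ltlq leln.
by rewrite dflow_diag_into row_entry_cell.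
Qed.

Lemma row_tail_le n j : (n < p)%N ->
  \sum_(j.+1 <= l < q.+1) row_entry n l <= \sum_(0 <= m < n.+1) dflow y m j.
Proof.
move=> ltnp; have d_ge0 : 0 <= \sum_(0 <= m < n.+1) dflow y m j.
  by apply: sumr_ge0 => m _; exact: dflow_ge0.
have [leqj|ltjq] := leqP q j; first by rewrite big_geq.
have [ltnj|lejn] := ltnP n j.
  rewrite big_nat big1// => l /andP[ltjl _].
  by rewrite row_entry_gt// (leq_trans _ ltjl).
have [c [<- <-]] := cell_exists ltnp ltjq lejn.
by rewrite row_entry_tail (le_trans (bar_le c))// sum_in_diag.
Qed.

Definition vtail (n t : nat) : R := \sum_(t <= j < q.+1) vflow y n j.

(** The value at 0 gives both laws the same mass: its drop to the value at 1 is the vertical flow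
    whose row stays empty. *)
Definition excess_tail (n t : nat) : R :=
  if t is 0 then vtail n 0
  else \sum_(t <= l < q.+1) (row_entry n l - dflow y n l.-1).

(** By (b) the row tail is at most the node flow in that tail one row down, which is vertical plus
    diagonal inflow; subtracting the diagonal part leaves [vtail]. *)
Lemma excess_tail_le n t : (n < p)%N -> excess_tail n t <= vtail n t.
Proof.
case: t => [//|j] ltnp; rewrite /excess_tail /vtail sumrB lerBlDr.
rewrite (le_trans (row_tail_le j ltnp))// -(tail_nflow y_flow)// -big_split/=.
by apply: ler_sum_nat => -[|k] // _; rewrite nflow_in.
Qed.

(* In row [n] a unit of flow sitting in column [j] moves to the matrix entry [l]
   of that row: along the diagonal arc to column [j.+1], or along the vertical
   arc with some entry [l <= j] distributed by the coupling. *)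
Definition transition (n j l : nat) : R :=
  (if l == j.+1 then dflow y n j else 0) +
  coupling (excess_tail n) (vtail n) j l.

Lemma row_coupling n : (n < p)%N -> let Z := coupling (excess_tail n) (vtail n) in
  [/\ forall j l, 0 <= Z j l, forall j l, (j < l)%N -> Z j l = 0,
    forall j, (j < q.+1)%N -> \sum_(0 <= l < q.+1) Z j l = vflow y n j &
    forall l, (l < q)%N -> \sum_(0 <= j < q.+1) Z j l.+1 =
      row_entry n l.+1 - dflow y n l].
Proof.
move=> ltnp Z.
have v_anti : {homo vtail n : s t / (s <= t)%N >-> t <= s}.
  by move=> s t; apply: tail_sum_le => k _; exact: vflow_ge0.
have e_anti : {homo excess_tail n : s t / (s <= t)%N >-> t <= s}.
  move=> [|s] [|t] // lest; last first.
    apply: tail_sum_le => // -[|k] // _.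
    by rewrite subr_ge0 dflow_le.
  (* Starting from index 0, monotonicity comes from the domination by [vtail]; between positive
     indices it came from (a). *)
  by apply: le_trans (excess_tail_le _ ltnp) _; exact: v_anti.
have [Z_ge0 Z_supp Z_row Z_col] := @monotone_coupling R q.+1 _ _ e_anti v_anti
  (fun t => excess_tail_le t ltnp) erefl (big_geq (leqnn _)) (big_geq (leqnn _)).
split=> // [j ltjq|l ltlq].
  by rewrite Z_row// /vtail big_ltn// addrK.
by rewrite Z_col ?ltnS// /excess_tail big_ltn// addrK.
Qed.

Lemma projection_in_orbitope : packing_orbitope R p q x.
Proof.
have [||||||I [w [f [w_ge0 sumw w_supp f_law]]]] :=
    @markov_realization R p q.+1 transition (nflow y).
- by [].
- move=> n j l ltnp; have [Z_ge0 _ _ _] := row_coupling ltnp.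
  by rewrite addr_ge0//; case: ifP => // _; exact: dflow_ge0.
- move=> n j l ltnp ltjl; have [_ Z_supp _ _] := row_coupling ltnp.
  by rewrite /transition gtn_eqF// add0r Z_supp// ltnW.
- move=> n j ltnp ltjq; have [_ _ Z_row _] := row_coupling ltnp.
  rewrite big_split/= Z_row// nflow_out// addrC; congr (_ + _).
  rewrite -big_mkcond big_nat1_eq/= ltnS; case: ltnP => // leqj.
  by rewrite dflow_ge.
(* Given [maxn j l = k], coupling terms survive only for [j = k], as they need [l <= j], and
   diagonal terms only for [l = j.+1 = k]. These are the two kinds of inflow to column [k]. *)
- move=> n k ltnp ltkq; have [_ Z_supp Z_row _] := row_coupling ltnp.
  under eq_bigr do rewrite big_split/=.
  rewrite big_split/= nflow_in addrC; congr (_ + _).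
    rewrite -Z_row//.
    transitivity (\sum_(0 <= j < q.+1 | j == k) \sum_(0 <= l < q.+1)
        coupling (excess_tail n) (vtail n) j l); last by rewrite big_nat1_eq ltkq.
    rewrite [RHS]big_mkcond/=; apply: eq_bigr => j _; case: eqP => [->|nejk].
      rewrite big_mkcond; apply: eq_bigr => l _; case: eqP => //.
      by case: (leqP l k) => [/maxn_idPl|/Z_supp ->].
    rewrite big1// => l /eqP maxk; apply: Z_supp; rewrite ltnNge.
    by apply/negP => /maxn_idPl; rewrite maxk => /esym.
  transitivity (\sum_(0 <= j < q.+1) if j.+1 == k then dflow y n j else 0).
    apply: eq_bigr => j _; case: eqP => [jk|nejk]; last first.
      rewrite big1// => l /eqP maxk; case: eqP => // lj.
      by case: nejk; rewrite -maxk lj; exact/esym/maxn_idPr.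
    rewrite big_mkcond; transitivity (\sum_(0 <= l < q.+1 | l == k) dflow y n j).
      rewrite [RHS]big_mkcond; apply: eq_bigr => l _; rewrite jk.
      case: (l =P k) => [->|]; last by rewrite if_same.
      by rewrite (maxn_idPr _) ?eqxx// -jk.
    by rewrite big_nat1_eq ltkq.
  case: k ltkq => [|k] ltkq; first by rewrite big1.
  by rewrite -big_mkcond big_nat1_eq (ltnW ltkq).
- exact: nflow_top.
pose M i := choice_matrix p q (f i).
have -> : x = \sum_i w i *: (cell_vector R (M i) : {ffun cell p q -> R^o}).
  apply/ffunP => c; rewrite sum_ffunE.
  transitivity (\sum_(i | f i (crow c) == (ccol c).+1) w i).
    (* The diagonal flow and the excess carried by the coupling add up to the entry of [x]. *)
    rewrite f_law ?ltnS// -row_entry_cell big_split/=.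
    have [_ _ _ Z_col] := row_coupling (ltn_ord (crow c)).
    rewrite Z_col// [RHS]addrC; apply/esym/eqP; rewrite addrAC subr_eq; apply/eqP.
    congr (_ + _); rewrite -big_mkcond/=; under eq_bigl do rewrite eqSS eq_sym.
    by rewrite big_nat1_eq ltnS (ltnW (ltn_ord _)).
  rewrite big_mkcond; apply: eq_bigr => i _; rewrite !ffunE mxE.
  by case: eqP => _; rewrite ?scaler0// [_ *: _]mulr1.
move=> A [cA GA]; apply: convex_set_sum => // i wi0; apply: GA.
exists (M i) => //; split; last exact: choice_matrix_packing.
by apply: choice_matrix_lex => n; exact: w_supp.
Qed.
End Projection.

(** * Lifting a matrix to a path *)

(** A discrete intermediate value argument: the peak never rises by more than one. *)
Lemma peak_crossing p g n j : restricted_growth p g -> (n <= p)%N ->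
  (j < peak g n)%N ->
  exists k, [/\ (k < n)%N, peak g k = j & peak g k.+1 = j.+1].
Proof.
move=> rg; elim: n => [|n IHn] ltnp; first by rewrite /peak big_ord0.
have [ltj _|lepj] := ltnP j (peak g n).
  have [k [ltkn pk pk']] := IHn (ltnW ltnp) ltj.
  by exists k; split=> //; rewrite ltnS ltnW.
rewrite peakS leq_max leqNgt ltnS lepj /= => ltjg.
have := rg _ ltnp; exists n; rewrite peakS; split=> //; lia.
Qed.

Section Lift.
Context {R : realType} {p q : nat} (g : nat -> nat).
Hypothesis g_le : forall i, (g i <= q)%N.
Hypothesis g_rg : restricted_growth p g.

(** Distance from the source. Each arc raises it by one, so a path has exactly one node per
    layer. *)
Definition layer (u : node p q) : nat :=
  match u with inl h => (grow h).+1 | inr false => 0%N | inr true => p.+2 end.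

(** The default of [insubd] is never reached, since the peak after [n] rows is at most [n]. *)
Definition path_node (k : nat) : node p q :=
  if k is n.+1 then
    if (n <= p)%N then
      inl (insubd (exist _ (ord0, ord0) isT : grid p q) (inord n, inord (peak g n)))
    else snk
  else src.

Definition on_path (u : node p q) : bool := u == path_node (layer u).

Lemma peak_le_q n : (peak g n <= q)%N.
Proof. by apply/bigmax_leqP => i _. Qed.

Lemma path_node_at n : (n <= p)%N ->
  exists h : grid p q, [/\ path_node n.+1 = inl h, grow h = n :> nat &
    gcol h = peak g n :> nat].
Proof.
move=> lenp; rewrite /path_node lenp; eexists; split; first by [].
  rewrite /grow val_insubd /= !inordK ?ltnS ?peak_le_q//.
  by rewrite (peak_le g_rg)//= inordK.
rewrite /gcol val_insubd /= !inordK ?ltnS ?peak_le_q//.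
by rewrite (peak_le g_rg)//= inordK ?ltnS ?peak_le_q.
Qed.

Lemma on_path_grid (h : grid p q) :
  on_path (inl h) = (gcol h == peak g (grow h) :> nat).
Proof.
have lehp : (grow h <= p)%N by rewrite -ltnS.
rewrite /on_path; have [h' [-> rE cE]] := path_node_at lehp.
apply/eqP/eqP => [[->]|hE]; first by rewrite cE rE.
by congr inl; apply: grid_inj; rewrite ?rE// cE.
Qed.

Lemma layer_path k : (k <= p.+2)%N -> layer (path_node k) = k.
Proof.
case: k => [//|n]; rewrite ltnS leq_eqVlt => /predU1P[->|].
  by rewrite /path_node ltnn.
by rewrite ltnS => /path_node_at[h [-> /= -> _]].
Qed.

Lemma on_path_node k : (k <= p.+2)%N -> on_path (path_node k).
Proof. by move=> lek; rewrite /on_path layer_path. Qed.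

Lemma layer_arc (a : arc p q) : layer (arc_head a) = (layer (arc_tail a)).+1.
Proof. by case: arcP => [h h' _ /= ->|h h' _ /= ->||h /= ->]. Qed.

Lemma layer_le (u : node p q) : (layer u <= p.+2)%N.
Proof. by case: u => [h|[]] //=; rewrite !ltnS ltnW. Qed.

(** The arc is vertical if row [n] leaves the peak unchanged and diagonal if it raises it,
    necessarily by one. *)
Lemma path_arc k : (k <= p.+1)%N ->
  exists2 a : arc p q, arc_tail a = path_node k & arc_head a = path_node k.+1.
Proof.
move=> lek; suff isa : is_arc (path_node k, path_node k.+1).
  by exists (exist _ (path_node k, path_node k.+1) isa).
case: k lek => [_|n].
  have [h [-> rE cE]] := path_node_at (leq0n p).
  apply/or4P; apply: Or43; rewrite /source_arc eqxx /=; apply/eqP; congr inl.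
  by apply: grid_inj; rewrite ?rE ?cE// /peak big_ord0.
rewrite ltnS => lenp; have [h [-> rE cE]] := path_node_at lenp.
move: lenp; rewrite leq_eqVlt => /predU1P[np|ltnp].
  have -> : path_node n.+2 = snk by rewrite /path_node np ltnn.
  by apply/or4P; apply: Or44; apply/eqP; rewrite rE.
have [h' [-> rE' cE']] := path_node_at ltnp.
have lemq := peak_le_q n.+1; have lemn := peak_le g_rg (ltnW ltnp).
have rgn := g_rg ltnp.
rewrite /is_arc /vertical_arc /diagonal_arc /= rE rE' cE cE' ltnp eqxx /=.
move: lemq; rewrite peakS !leq_min lemn ltnS lemn /=.
case: (leqP (g n) (peak g n)) => [_ lemq|lt lemq].
  by rewrite eqxx lemq.
have gE : g n = (peak g n).+1 by apply/eqP; rewrite eqn_leq rgn.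
by rewrite gE in lemq *; rewrite lemq eqxx orbT.
Qed.

Definition path_flow : {ffun arc p q -> R} :=
  [ffun a => (on_path (arc_tail a) && on_path (arc_head a))%:R].

(** The layer of the head determines that of the tail, so exactly one path arc enters a path node
    other than the source. *)
Lemma path_flow_in v : v != src ->
  \sum_(a | arc_head a == v) path_flow a = (on_path v)%:R.
Proof.
move=> v_src; have [on_v|off_v] := boolP (on_path v); last first.
  by rewrite big1// => a /eqP hE; rewrite ffunE hE (negPf off_v) andbF.
have [k lvk] : exists k, layer v = k.+1.
  by case: v v_src {on_v} => [h|[]] //= _; eexists.
have lek : (k <= p.+1)%N by rewrite -ltnS -lvk layer_le.
have [a0 tE hE] := path_arc lek; have vE : v = path_node k.+1 by rewrite -lvk; exact/eqP.
have ya0 : path_flow a0 = 1.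
  by rewrite ffunE tE hE (on_path_node (leqW lek)) (@on_path_node k.+1).
rewrite (bigD1 a0); last by rewrite hE -vE eqxx.
rewrite ya0 big1 => [|a]; first exact: addr0.
move=> /andP[/eqP aE na]; rewrite ffunE.
case: (boolP (on_path _)) => //= /eqP tE'; case/eqP: na; apply: arc_inj.
  rewrite tE tE'; congr path_node; apply: succn_inj.
  by rewrite -layer_arc aE.
by rewrite aE hE.
Qed.

Lemma path_flow_out v : v != snk ->
  \sum_(a | arc_tail a == v) path_flow a = (on_path v)%:R.
Proof.
move=> v_snk; have [on_v|off_v] := boolP (on_path v); last first.
  by rewrite big1// => a /eqP tE; rewrite ffunE tE (negPf off_v).
have lek : (layer v <= p.+1)%N.
  by case: v v_snk {on_v} => [h|[]] //= _; rewrite ltnS -ltnS.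
have [a0 tE hE] := path_arc lek; have vE : v = path_node (layer v) by exact/eqP.
have ya0 : path_flow a0 = 1.
  by rewrite ffunE tE hE (on_path_node (leqW lek)) (@on_path_node (layer v).+1).
rewrite (bigD1 a0); last by rewrite tE -vE eqxx.
rewrite ya0 big1 => [|a]; first exact: addr0.
move=> /andP[/eqP aE na]; rewrite ffunE andbC.
case: (boolP (on_path _)) => //= /eqP hE'; case/eqP: na; apply: arc_inj.
  by rewrite tE aE.
by rewrite hE hE' layer_arc aE.
Qed.

Lemma path_flow_unit : unit_flows R p q path_flow.
Proof.
split=> [a|v v_src v_snk|]; first by rewrite ffunE ler0n.
  by rewrite path_flow_in// path_flow_out.
by rewrite path_flow_out// (on_path_node (leq0n _)).
Qed.

Lemma path_flow_diag_into (c : cell p q) :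
  path_flow (diag_into c) =
  ((peak g (crow c) == ccol c :> nat) &&
   (peak g (crow c).+1 == (ccol c).+1 :> nat))%:R.
Proof.
rewrite ffunE !on_path_grid /grow /gcol /= /bump !leq0n !add1n.
by rewrite ![_ == peak _ _]eq_sym.
Qed.

(** For (a), a diagonal step means that the row raised the peak to its own entry. For (b), a bar
    holds at most one 1; if it holds one, the peak has passed the column of [c], and the crossing
    used a diagonal arc into [column_nodes c]. *)
Lemma choice_matrix_lift :
  extended_polytope R p q (cell_vector R (choice_matrix p q g), path_flow).
Proof.
split=> /= [|c|c]; first exact: path_flow_unit.
  rewrite path_flow_diag_into ffunE mxE.
  case: eqP => //= pE; case: eqP => [pE'|]; last by rewrite ler0n.
  move: pE'; rewrite peakS pE => maxE.
  suff -> : g (crow c) = (ccol c).+1 by rewrite eqxx.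
  lia.
have y_ge0 : 0 <= coord_sum path_flow (in_diag (column_nodes c)).
  by apply: sumr_ge0 => a _; rewrite ffunE ler0n.
case: (pickP (fun d => (d \in bar c) && (g (crow c) == (ccol d).+1))); last first.
  move=> none; rewrite /coord_sum big1// => d d_bar; rewrite ffunE mxE.
  move: (none d) d_bar; rewrite inE => + /andP[/eqP rE le].
  by rewrite rE eqxx le /= => ->.
move=> d /andP[d_bar /eqP gE].
apply: (@le_trans _ _ 1).
  rewrite /coord_sum (bigD1 d)//= big1 ?addr0; first by rewrite ffunE mxE lern1 leq_b1.
  move=> e /andP[]; rewrite ffunE mxE; move: d_bar; rewrite !inE.
  case/andP => /eqP rd _ /andP[/eqP re _] ned; rewrite re gE eqSS.
  case: eqP => // cE; case/eqP: ned; apply: val_inj.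
  rewrite [LHS]surjective_pairing [RHS]surjective_pairing.
  by congr pair; [rewrite -/(crow e) -/(crow d) re rd|exact/val_inj].
have ltjp : (ccol c < peak g (crow c).+1)%N.
  move: d_bar; rewrite inE => /andP[_ lecd].
  by rewrite peakS leq_max gE ltnS lecd orbT.
have [k [ltk pk pk']] := peak_crossing g_rg (ltn_ord (crow c)) ltjp.
have [e [rE cE]] : exists e : cell p q, crow e = k :> nat /\ ccol e = ccol c :> nat.
  apply: cell_exists => //; first exact: leq_trans ltk (ltn_ord _).
  by rewrite -pk (peak_le g_rg)// (leq_trans (ltnW ltk)).
have e_in : diag_into e \in in_diag (column_nodes c).
  have := is_diagonal_diag_into e; rewrite inE /is_diagonal => ->.
  rewrite !mem_column_nodes.
  by rewrite /grow /gcol /= /bump !leq0n !add1n rE cE eqxx ltk ltn_eqF.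
rewrite /coord_sum (bigD1 _ e_in)/= path_flow_diag_into rE cE pk pk' !eqxx lerDl.
by apply: sumr_ge0 => a _; rewrite ffunE ler0n.
Qed.
End Lift.

(** * Convexity of the projection and conclusion *)

Lemma extended_polytope_convex (R : realType) (p q : nat) :
  convex_set ([set xy.1 | xy in extended_polytope R p q]%classic
    : set {ffun cell p q -> R^o}).
Proof.
move=> x1 x2 t; rewrite !inE => -[[z1 y1] /= [[y1_ge0 y1_c y1_s] D1 B1] <-].
move=> [[z2 y2] /= [[y2_ge0 y2_c y2_s] D2 B2] <-].
have t_ge0 : 0 <= t%:num by [].
have t'_ge0 : 0 <= 1 - t%:num by rewrite subr_ge0.
pose mix (E : finType) (u v : {ffun E -> R}) : {ffun E -> R} :=
  [ffun e => t%:num * u e + (1 - t%:num) * v e].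
have mix_sum (E : finType) (P : pred E) (u v : {ffun E -> R}) :
    \sum_(e | P e) mix E u v e =
    t%:num * (\sum_(e | P e) u e) + (1 - t%:num) * (\sum_(e | P e) v e).
  by rewrite !mulr_sumr -big_split/=; apply: eq_bigr => e _; rewrite ffunE.
exists (mix _ z1 z2, mix _ y1 y2); last first.
  by apply/ffunP => c; rewrite !ffunE.
split=> /= [|c|c].
- split=> [a|v v_src v_snk|]; first by rewrite ffunE addr_ge0// mulr_ge0.
    by rewrite !mix_sum y1_c// y2_c.
  by rewrite mix_sum y1_s y2_s; lra.
- by rewrite !ffunE lerD// ler_wpM2l.
- by rewrite /coord_sum !mix_sum lerD// ler_wpM2l// ?B1// B2.
Qed.

Theorem theorem6 (R : realType) (p q : nat) (hq : (1 <= q)%N) (hqp : (q <= p)%N) :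
  packing_orbitope R p q = [set xy.1 | xy in extended_polytope R p q]%classic.
Proof.
apply/seteqP; split=> [|x [[x' y] /= [y_flow diag_le bar_le] <-]].
  (* The hull is the smallest convex set, so only its generating matrices need a lift. *)
  apply: smallest_sub; first exact: extended_polytope_convex.
  move=> _ [M [lexM packM] <-].
  have [g [g_le g_rg ->]] := choice_matrixP lexM packM.
  by exists (cell_vector R (choice_matrix p q g), path_flow g);
    first exact: choice_matrix_lift.
exact: projection_in_orbitope y_flow diag_le bar_le.
Qed.
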